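(* Let $p$ be an odd prime. Let $q=p^3$ and let $d$ be a (positive) divisor of $p^2+p+1$. If $d>p$, then $\omega(GP(q,d))=p$.
   Context: $\mathbb{F}_q$ is the finite field with $q$ elements and $\mathbb{F}_q^*=\mathbb{F}_q\setminus\{0\}$. For an integer $d>1$ and an odd prime power $q\equiv 1\pmod{2d}$ (this congruence holds automatically under the hypotheses of the claim), the $d$-Paley graph $GP(q,d)$ is the graph with vertex set $\mathbb{F}_q$ in which two vertices are adjacent if and only if their difference lies in $(\mathbb{F}_q^* )^d=\{x^d: x\in\mathbb{F}_q^*\}$. The clique number $\omega(X)$ of a graph $X$ is the maximum number of vertices of a complete subgraph of $X$. *)

(* Defs.v *)
From HB Require Import structures.
From mathcomp Require Import all_boot all_order all_algebra.

Set Implicit Arguments.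
Unset Strict Implicit.
Unset Printing Implicit Defensive.

Import GRing.Theory.
Local Open Scope ring_scope.

Definition nonzero_powers (F : finFieldType) (d : nat) : {set F} :=
  [set x ^+ d | x in [set x : F | x != 0]].

(* When #|F| is congruent to 1 modulo 2d, -1 is a d-th power, so this relation
   is symmetric; it is always irreflexive. *)
Definition paley_graph (F : finFieldType) (d : nat) : rel F :=
  fun x y => x - y \in nonzero_powers F d.

Arguments paley_graph : clear implicits.

Definition clique (T : finType) (e : rel T) (A : {set T}) : bool :=
  [forall x in A, forall y in A, (x != y) ==> e x y].

Definition clique_number (T : finType) (e : rel T) : nat :=
  \max_(A : {set T} | clique e A) #|A|.

(* Main.v *)
(* Lower bound: every nonzero element of the prime subfield is a d-th power,
   since its (p-1)-st power is 1 and p - 1 divides (q-1)/d.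

   Upper bound (Stepanov's method, after Hanson and Petridis): put
   m = (q-1)/d = (p-1)k with k = (p^2+p+1)/d, so that k < p because d > p.
   Differences of distinct elements of a clique A are m-th roots of unity.
   Choose a_1, ..., a_k in A and weights c_i with sum_i c_i (x - a_i)^e equal to
   0 for e < k-1 and to 1 for e = k-1.  The polynomial
   sum_i c_i (X - a_i)^(m+k-1) - 1 has degree m, its leading coefficient being
   binomial(m+k-1, m) = binomial(kp-1, k-1), which is nonzero modulo p.  It
   vanishes to order k-1 at each a_i and to order k elsewhere on A, so
   k(|A| - 1) <= m, that is |A| <= p. *)
Require Import Defs.
From HB Require Import structures.
From mathcomp Require Import all_boot all_order all_algebra.
From mathcomp Require Import cyclic finfield zify ring.

Set Implicit Arguments.
Unset Strict Implicit.
Unset Printing Implicit Defensive.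

Import GRing.Theory.
Local Open Scope ring_scope.

(** Powers of distinct linear factors are coprime, so their product divides [f]. *)
Lemma sum_multiplicities_lt_size (F : fieldType) (f : {poly F}) (s : seq F)
    (r : F -> nat) :
  f != 0 -> uniq s ->
  {in s, forall a, ('X - a%:P) ^+ r a %| f} -> (\sum_(a <- s) r a < size f)%N.
Proof.
move=> f_neq0 s_uniq dvd_f.
have: \prod_(a <- s) ('X - a%:P) ^+ r a %| f.
  elim: s s_uniq dvd_f => [|a s IHs] /=; first by rewrite big_nil dvd1p.
  case/andP=> a_notin s_uniq dvd_f; rewrite big_cons Gauss_dvdp.
    rewrite dvd_f ?mem_head //= IHs // => b sb.
    by rewrite dvd_f // inE sb orbT.
  rewrite big_seq; apply: (big_ind (fun q => coprimep _ q)) => [|q1 q2|b sb].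
  - exact: coprimep1.
  - by rewrite coprimepMr => -> ->.
  - rewrite coprimep_expl // coprimep_expr // coprimep_XsubC2 // subr_eq0.
    by apply: contraNneq a_notin => <-.
move/(dvdp_leq f_neq0); apply: leq_trans.
elim: (s) => [|a t IHt]; first by rewrite !big_nil size_poly1.
have prod_neq0: \prod_(b <- t) ('X - b%:P) ^+ r b != 0.
  by rewrite prodf_seq_neq0; apply/allP=> b _; rewrite /= expf_neq0 ?polyXsubC_eq0.
rewrite !big_cons size_mul ?expf_neq0 ?polyXsubC_eq0 // size_exp_XsubC.
by rewrite addSn /= -addnS leq_add2l.
Qed.

(** An invertible Vandermonde system prescribes the moments of the weights at 0; the binomial
    expansion transfers this to every [x], since only the moment of order [n] is nonzero. *)
Lemma exists_power_weights (F : fieldType) (n : nat) (a : 'I_n.+1 -> F) :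
  injective a ->
  exists c : 'I_n.+1 -> F, forall (x : F) (e : nat), (e <= n)%N ->
    \sum_i c i * (x - a i) ^+ e = (e == n)%:R.
Proof.
move=> a_inj; pose V := Vandermonde n.+1 (\row_i a i).
have V_unit: V \in unitmx.
  rewrite unitmxE unitfE det_Vandermonde.
  apply/prodf_neq0 => i _; apply/prodf_neq0 => j lt_ij.
  rewrite !mxE subr_eq0; apply: contraTneq lt_ij => /a_inj ->.
  by rewrite ltnn.
(* The sign offsets the factor [(-1) ^+ n] of [a i ^+ n] in [(x - a i) ^+ n]. *)
pose c := invmx V *m ((-1) ^+ n *: delta_mx ord_max 0) : 'cV_n.+1.
have moment j: (j <= n)%N -> \sum_i c i 0 * a i ^+ j = (-1) ^+ n * (j == n)%:R.
  rewrite -ltnS => lt_jn.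
  have: (V *m c) (Ordinal lt_jn) 0 = (-1) ^+ n * (j == n)%:R.
    by rewrite mulKVmx // !mxE eqxx andbT.
  by rewrite mxE => <-; apply: eq_bigr => i _; rewrite !mxE mulrC.
exists (fun i => c i 0) => x e le_en.
under eq_bigr => i _.
  rewrite exprBn mulr_sumr.
  under eq_bigr => j _.
    rewrite (_ : _ * _ = (-1) ^+ j * x ^+ (e - j) * 'C(e, j)%:R
                           * (c i 0 * a i ^+ j)); last by ring.
    over.
  over.
rewrite exchange_big /=.
under eq_bigr => j _ do
  rewrite -mulr_sumr moment ?(leq_trans (leq_ord j)) //.
rewrite big_ord_recr /= big1 ?add0r => [|j _]; last first.
  by rewrite (ltn_eqF (leq_trans (ltn_ord j) le_en)) !mulr0.
rewrite subnn binn; case: eqP => [->|_]; last by rewrite !mulr0.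
by rewrite expr0 !mulr1 -expr2 sqrr_sign.
Qed.

(** Here [s] holds the nodes [a i] and [t] the rest of the clique. Roots in [s] count [n] times and
    those in [t] count [n.+1] times, against a degree of at most [m]. *)
Lemma stepanov_bound (F : fieldType) (m n : nat) (s t : seq F) :
  (0 < m)%N -> size s = n.+1 -> uniq (s ++ t) ->
  {in s & s ++ t, forall a b, a != b -> (b - a) ^+ m = 1} ->
  'C(m + n, m)%:R != 0 :> F ->
  (n.+1 * (n + size t) <= m)%N.
Proof.
move=> m_gt0 size_s uniq_st pow1 bin_neq0.
have uniq_s : uniq s by move: uniq_st; rewrite cat_uniq => /andP[].
pose a (i : 'I_n.+1) := s`_i.
have s_a i : a i \in s by rewrite mem_nth // size_s.
have a_inj : injective a.
  move=> i j /eqP; rewrite /a nth_uniq ?size_s // => /eqP; exact: val_inj.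
have [c cP] := exists_power_weights a_inj.
pose f : {poly F} := \sum_i c i *: ('X - (a i)%:P) ^+ (m + n) - 1.
(* Expanding f around x turns the multiplicity of x as a root into the vanishing
   of the first coefficients. *)
have f_shift x : f = \sum_(j < (m + n).+1)
    ((\sum_i c i * (x - a i) ^+ (m + n - j)) *+ 'C(m + n, j))
      *: ('X - x%:P) ^+ j - 1.
  congr (_ - 1).
  under eq_bigr => i _.
    rewrite (_ : 'X - _ = (x - a i)%:P + ('X - x%:P)); last first.
      by rewrite polyCB; ring.
    rewrite exprDn scaler_sumr.
    over.
  rewrite exchange_big /=; apply: eq_bigr => j _.
  rewrite -sumrMnl scaler_suml; apply: eq_bigr => i _.
  by rewrite -polyC_exp mul_polyC -!scalerMnl -scalerMnr scalerA.
have coef_f j : (j <= m + n)%N -> j != 0%N ->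
    f`_j = (\sum_i c i * (0 - a i) ^+ (m + n - j)) *+ 'C(m + n, j).
  move=> le_j j_neq0; rewrite (f_shift 0) polyC0 subr0 coefB coef1 (negPf j_neq0).
  rewrite subr0 coef_sum (bigD1 (Ordinal (le_j : (j < (m + n).+1)%N))) //=.
  rewrite coefZ coefXn eqxx mulr1 [X in _ + X]big1 ?addr0 // => i neq_ij.
  rewrite coefZ coefXn (_ : (j == i) = false) ?mulr0 //.
  by apply: contraNF neq_ij => /eqP ji; apply/eqP/val_inj; rewrite /= -ji.
(* Beyond degree [m] the weighted power sums have exponent below [n], hence vanish. *)
have size_f : (size f <= m.+1)%N.
  apply/leq_sizeP => j lt_mj; case: (leqP j (m + n)) => [le_j | lt_j].
    rewrite coef_f //; last by rewrite -lt0n (leq_trans _ lt_mj).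
    have lt_n : (m + n - j < n)%N by move: lt_mj le_j; clear; lia.
    by rewrite cP ?(ltnW lt_n) // (ltn_eqF lt_n) mul0rn.
  have j_gt0 : (0 < j)%N by exact: leq_ltn_trans lt_mj.
  rewrite (f_shift 0) coefB coef1 coef_sum (gtn_eqF j_gt0) subr0 big1 // => i _.
  by rewrite polyC0 subr0 coefZ coefXn (gtn_eqF (leq_trans (ltn_ord i) lt_j)) mulr0.
(* In degree [m] the exponent is exactly [n], which leaves the coefficient ['C(m + n, m)]. *)
have f_neq0 : f != 0.
  apply: contraNneq bin_neq0 => f0.
  have := coef_f m (leq_addr _ _); rewrite -lt0n f0 coef0 addKn => /(_ m_gt0).
  by rewrite cP // eqxx => <-.
(* For [j < r] the exponent [m + n - j] may be lowered to [n - j]: the term [j = 0] cancels the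
   constant [- 1], and the other terms of order below [r] vanish. *)
have dvd_f x r : (r <= n.+1)%N ->
    (forall i e, (n.+1 - r <= e)%N -> (x - a i) ^+ (m + e) = (x - a i) ^+ e) ->
    ('X - x%:P) ^+ r %| f.
  move=> le_rn powD; rewrite (f_shift x) big_ord_recl /= subn0 expr0 bin0 mulr1n.
  have sumE j : (j < r)%N ->
      \sum_i c i * (x - a i) ^+ (m + n - j) = (j == 0%N)%:R.
    move=> lt_jr; have le_jn : (j <= n)%N by exact: leq_trans lt_jr le_rn.
    have <- : (n - j == n)%N = (j == 0%N) by move: le_jn; clear; lia.
    rewrite -(cP x) ?leq_subr //; apply: eq_bigr => i _.
    by rewrite -addnBA // powD // -(subSS j) leq_sub2l.
  case: (posnP r) => [-> | r_gt0]; first by rewrite expr0 dvd1p.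
  have := sumE 0%N r_gt0; rewrite subn0 => ->; rewrite scale1r addrAC subrr add0r.
  apply: (big_ind (dvdp _)) => [|q1 q2|j _]; [exact: dvdp0 | exact: dvdp_add |].
  rewrite /= /bump leq0n add1n.
  case: (ltnP j.+1 r) => [lt_jr | le_rj].
    by rewrite sumE // mul0rn scale0r dvdp0.
  by rewrite -mul_polyC dvdp_mull // dvdp_exp2l.
(* For x = a_i the base is 0 and the exponent e must be positive: this costs one
   order of vanishing at the points of s. *)
have pow_ext x i e : x \in s ++ t -> (0 < e)%N || (x \notin s) ->
    (x - a i) ^+ (m + e) = (x - a i) ^+ e.
  move=> st_x; case: (eqVneq (a i) x) => [<- | neq_ax _]; last first.
    by rewrite exprD pow1 ?mul1r.
  rewrite s_a orbF => e_gt0.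
  by rewrite subrr !expr0n addn_eq0 (gtn_eqF m_gt0) (gtn_eqF e_gt0).
have : (\sum_(x <- s ++ t) (if x \in s then n else n.+1) < size f)%N.
  apply: sum_multiplicities_lt_size => // x st_x.
  case: ifP => s_x; apply: dvd_f => // i e le_e; apply: pow_ext => //.
    by rewrite (leq_trans _ le_e) // subSnn.
  by rewrite s_x orbT.
move/leq_trans/(_ size_f); rewrite ltnS big_cat /=.
rewrite (eq_big_seq (fun=> n)) => [|x ->//].
rewrite [X in (_ + X)%N](eq_big_seq (fun=> n.+1)) => [|x t_x]; last first.
  by move: uniq_st; rewrite cat_uniq => /and3P[_ /hasPn/(_ _ t_x)/negPf -> _].
by rewrite !big_const_seq !count_predT !iter_addn_0 size_s (mulnC n) -mulnDr.
Qed.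

(** The multiplicative group is cyclic: if [y = z ^+ i] with [z] a generator, then [d * m] divides
    [i * m], so [d] divides [i]. *)
Lemma is_power_of_root (F : finFieldType) (d m : nat) (y : F) :
  #|F| = (d * m).+1 -> (0 < m)%N -> y ^+ m = 1 -> y \in nonzero_powers F d.
Proof.
move=> cardF m_gt0 ym1; pose n := (d * m)%N.
have n_gt0 : (0 < n)%N by have := finNzRing_gt1 F; rewrite cardF ltnS.
have pow1 x : x != 0 -> x ^+ n = 1 :> F.
  by move=> x_neq0; apply: (mulfI x_neq0); rewrite mulr1 -exprS -cardF expf_card.
have [z z_prim]: exists z : F, n.-primitive_root z.
  have /hasP[z _ zP]: has n.-primitive_root (enum [set x : F | x != 0]).
    apply: has_prim_root => //; last 2 first.
    - exact: enum_uniq.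
    - by rewrite -cardE cardsE (cardC1 0) cardF.
    by apply/allP=> x; rewrite mem_enum inE unity_rootE => /pow1 ->.
  by exists z.
have y_root : y ^+ n = 1 by rewrite /n mulnC exprM ym1 expr1n.
have [i y_zi] := prim_rootP z_prim y_root.
have /dvdnP[k i_kd]: (d %| i)%N.
  rewrite -(dvdn_pmul2r m_gt0) (prim_order_dvd z_prim) exprM -y_zi.
  by rewrite ym1.
apply/imsetP; exists (z ^+ k); last by rewrite y_zi i_kd exprM.
by rewrite inE expf_neq0 // (prim_root_eq0 z_prim) -lt0n.
Qed.

(** The factors of the falling factorial are congruent to [- i.+1] modulo [p], with
    [0 < i.+1 < p]. *)
Lemma prime_ndvd_bin (p k : nat) :
  prime p -> (0 < k < p)%N -> ~~ (p %| 'C(k * p - 1, k - 1))%N.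
Proof.
move=> p_prime lt_kp.
suff: ~~ (p %| (k * p - 1) ^_ (k - 1))%N.
  by apply: contra => dvd_bin; rewrite -bin_ffact dvdn_mulr.
rewrite ffact_prod.
apply: (big_ind (fun x => ~~ (p %| x)%N)) => [|x y ndvd_x ndvd_y|i _].
- by rewrite dvdn1 neq_ltn prime_gt1 ?orbT.
- by rewrite Euclid_dvdM // negb_or ndvd_x.
- apply/negP => dvd_i; have lt_i := ltn_ord i.
  have: (p %| i.+1)%N.
    rewrite -(dvdn_addr _ dvd_i) (_ : _ + _ = k * p)%N ?dvdn_mull //.
    have : (i.+1 < k * p)%N by nia.
    by clear; lia.
  by move/dvdn_leq => /(_ isT); lia.
Qed.

(** The case [k = p] would make [p] divide 1, and [k > p] would give [d * k >= (p + 1) ^ 2]. *)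
Lemma cofactor_lt (p d k : nat) :
  (1 < p)%N -> (p < d)%N -> (d * k = p ^ 2 + p + 1)%N -> (k < p)%N.
Proof.
move=> p_gt1 lt_pd dk; rewrite ltnNge; apply/negP; rewrite leq_eqVlt.
case/orP=> [/eqP eq_pk | lt_pk].
  have : (p %| p ^ 2 + p + 1)%N by rewrite -dk -eq_pk dvdn_mull.
  by rewrite dvdn_addr ?dvdn_add ?dvdn_exp // dvdn1 (gtn_eqF p_gt1).
have := leq_mul lt_pd lt_pk; rewrite dk; nia.
Qed.

Lemma paley_cliqueP (F : finFieldType) (d : nat) (A : {set F}) :
  reflect {in A &, forall x y, x != y -> x - y \in nonzero_powers F d}
          (clique (paley_graph F d) A).
Proof.
apply: (iffP forall_inP) => [A_cl x y Ax Ay | A_cl x Ax].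
  by move/implyP: (forall_inP (A_cl x Ax) y Ay).
by apply/forall_inP => y Ay; apply/implyP; exact: A_cl.
Qed.

Lemma prime_subfield_clique (F : finFieldType) (p d k : nat) :
  p \in [pchar F] -> (0 < k)%N -> #|F| = (d * (p.-1 * k)).+1 ->
  clique (paley_graph F d) [set (i : nat)%:R | i : 'I_p].
Proof.
move=> pchar k_gt0 cardF; have p_gt1 := prime_gt1 (pcharf_prime pchar).
apply/paley_cliqueP => _ _ /imsetP[i _ ->] /imsetP[j _ ->].
rewrite -subr_eq0 => z_neq0.
apply: is_power_of_root cardF _ _; first by rewrite muln_gt0 k_gt0 -subn1 subn_gt0 p_gt1.
rewrite exprM (_ : _ ^+ p.-1 = 1) ?expr1n //.
(* Images of integers are fixed by Frobenius, hence so is their difference. *)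
apply: (mulfI z_neq0); rewrite mulr1 -exprS prednK; last exact: ltnW.
rewrite -(pFrobenius_autE pchar) pFrobenius_autB_comm ?pFrobenius_aut_nat //.
exact: mulrC.
Qed.

Lemma card_prime_subfield (F : finFieldType) (p : nat) :
  p \in [pchar F] -> #|[set (i : nat)%:R | i : 'I_p] : {set F}| = p.
Proof.
move=> pchar; rewrite card_imset ?card_ord // => i j.
wlog le_ij: i j / (i <= j)%N => [IH | eq_ij].
  by case/orP: (leq_total i j) => ? ?; [exact: IH | apply/esym/IH].
apply/val_inj/eqP; rewrite eqn_leq le_ij /=.
have: (p %| j - i)%N by rewrite (dvdn_pcharf pchar) natrB // eq_ij subrr.
have lt_jp := ltn_ord j; case: (posnP (j - i)) => [|gt0 /(dvdn_leq gt0)]; lia.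
Qed.

Local Close Scope ring_scope.

Theorem theorem1p5 (p d : nat) (F : finFieldType)
    (p_prime : prime p) (p_odd : odd p) (cardF : #|F| = p ^ 3)
    (d_dvd : d %| p ^ 2 + p + 1) (p_lt_d : p < d) :
  clique_number (paley_graph F d) = p.
Proof.
have pchar := card_finPcharP cardF p_prime.
have p_gt1 := prime_gt1 p_prime.
have [k dk] := dvdnP d_dvd; rewrite mulnC in dk.
have lt_kp : k < p by apply: (@cofactor_lt p d) => //; rewrite -dk.
have k_gt0 : 0 < k by case: k dk {lt_kp} => //; rewrite muln0 addn1.
pose m := p.-1 * k.
have m_gt0 : 0 < m by rewrite muln_gt0 k_gt0 -subn1 subn_gt0 p_gt1.
have cardFm : #|F| = (d * m).+1.
  by rewrite cardF /m mulnCA -dk; case: (p) p_gt1 => // q _ /=; ring.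
apply/eqP; rewrite eqn_leq; apply/andP; split; last first.
  rewrite -[X in X <= _](card_prime_subfield pchar).
  by apply: leq_bigmax_cond; exact: prime_subfield_clique cardFm.
apply/bigmax_leqP => A /paley_cliqueP A_cl.
(* Only a clique with more than [k] points needs the polynomial argument; its first [k] points are
   the nodes, so [n] is [k.-1]. *)
case: (leqP #|A| k) => [le_Ak | lt_kA]; first exact: leq_trans (ltnW lt_kp).
have size_take_k : size (take k (enum A)) = k.-1.+1.
  by rewrite size_takel ?prednK // -cardE ltnW.
have : k.-1.+1 * (k.-1 + size (drop k (enum A))) <= m.
  apply: stepanov_bound size_take_k _ _ _ => //.
  - by rewrite cat_take_drop enum_uniq.
  - rewrite cat_take_drop => a b /mem_take; rewrite !mem_enum => Aa Ab neq_ab.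
    have /imsetP[x] := A_cl b a Ab Aa (contra_neq esym neq_ab).
    rewrite inE => x_neq0 ->; rewrite -exprM.
    by apply: (mulfI x_neq0); rewrite mulr1 -exprS -cardFm expf_card.
  - rewrite -(dvdn_pcharf pchar) -bin_sub ?leq_addr // addKn.
    have -> : m + k.-1 = k * p - 1.
      rewrite /m; case: (k) k_gt0 => // k' _; case: (p) p_gt1 => // p' _ /=.
      by clear; lia.
    by rewrite -subn1 prime_ndvd_bin // k_gt0.
(* The bound reads [k * (#|A| - 1) <= (p - 1) * k], and [k] cancels. *)
by rewrite size_drop -cardE prednK // /m mulnC leq_pmul2r //; lia.
Qed.
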